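(* There exist standard Borel spaces $\Theta, X, Y$ and Markov kernels $f\colon\Theta\to X$ and $g\colon\Theta\to Y$ such that: (a) there is a Markov kernel $c\colon X\times P\Theta\to Y$ such that for every $\pi\in P\Theta$ and all measurable $S\subseteq\Theta$, $T\subseteq Y$, $$\int_S\int_X c(T\mid x,\pi)\,f(dx\mid\theta)\,\pi(d\theta)=\int_S g(T\mid\theta)\,\pi(d\theta);$$ (b) there is no Markov kernel $c\colon X\to Y$ with $g=c\circ f$.
   Context: A Markov kernel $k\colon A\to B$ between standard Borel spaces assigns to every $a\in A$ a probability measure $k(-\mid a)$ on $B$ such that $a\mapsto k(T\mid a)$ is measurable for every measurable $T\subseteq B$. Composition is $(c\circ f)(T\mid\theta)=\int_X c(T\mid x)\,f(dx\mid\theta)$. $P\Theta$ is the standard Borel space of probability measures on $\Theta$, with the $\sigma$-algebra generated by the evaluation maps $\pi\mapsto\pi(S)$ for measurable $S\subseteq\Theta$. In the Markov category $\mathsf{BorelStoch}$ of standard Borel spaces and Markov kernels, condition (a) is the statement that $f$ is more informative than $g$ in the Bayesian sense: in terms of the sampling kernel $\mathrm{samp}_\Theta\colon P\Theta\to\Theta$, $\mathrm{samp}_\Theta(-\mid\pi)=\pi$, it says $$(\mathrm{id}_\Theta\otimes c)\circ(\mathrm{id}_\Theta\otimes f\otimes\mathrm{id}_{P\Theta})\circ(\mathrm{copy}_\Theta\otimes\mathrm{id}_{P\Theta})\circ(\mathrm{samp}_\Theta\otimes\mathrm{id}_{P\Theta})\circ\mathrm{copy}_{P\Theta}=(\mathrm{id}_\Theta\otimes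 g)\circ\mathrm{copy}_\Theta\circ\mathrm{samp}_\Theta,$$ where $\mathrm{copy}$ is the kernel $x\mapsto\delta_{(x,x)}$. *)

(* Defs.v *)
From HB Require Import structures.
From mathcomp Require Import all_boot all_order all_algebra.
From mathcomp Require Import all_classical all_reals all_analysis.
Import numFieldNormedType.Exports.

Set Implicit Arguments.
Unset Strict Implicit.
Unset Printing Implicit Defensive.

Local Open Scope classical_set_scope.
Local Open Scope ring_scope.

Definition complete_metric (R : realType) (M : metricType R) : Prop :=
  forall u : nat -> M, cauchy (u @ \oo) -> exists x : M, u @ \oo --> x.

Definition separable (M : topologicalType) : Prop :=
  exists2 D : set M, countable D & dense D.

Definition borel (M : topologicalType) : set (set M) := <<s @open M >>.

(* T is isomorphic, as a measurable space, to a complete separable metric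
   space with its Borel sigma-algebra. *)
Definition standard_borel (R : realType) (d : measure_display)
    (T : measurableType d) : Prop :=
  exists (M : metricType R) (h : T -> M),
    [/\ complete_metric M, separable M, bijective h &
        forall A : set T, measurable A <-> borel (h @` A)].

(* Values of measures on non-measurable sets carry no meaning, hence the
   restriction to measurable T. *)
Definition is_composite (R : realType) (d1 d2 d3 : measure_display)
    (A : measurableType d1) (X : measurableType d2) (Y : measurableType d3)
    (g : R.-pker A ~> Y) (c : R.-pker X ~> Y) (f : R.-pker A ~> X) : Prop :=
  forall (a : A) (T : set Y), measurable T -> g a T = kcomp_noparam f c a T.

(* Main.v *)
(* A finitely additive probability on the subsets of nat vanishing on singletons
   solves the linear equations c(x) + c(y) + c(z) = 1 for (x, y, z) a partition of
   nat up to a finite set, and c(empty) = 0.  A parameter encodes such a triple,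
   f draws one of x, y, z uniformly, and g = Bernoulli(1/3); all other parameters
   impose c(empty) = 0.  Then g = c o f says that c(- {true}) solves the equations.

   The point masses x |-> x_m solve each equation as soon as m is large.  For a
   fixed prior pi, nearly norm-minimal convex combinations of the tails of this
   sequence form a Cauchy sequence in L^2, a subsequence of which converges almost
   everywhere; picking the combinations in a countable family by a first-choice
   rule makes the limit jointly measurable in (x, pi).  This is condition (a).

   A Borel solution would be invariant under finite changes, so by the topological
   zero-one law {c < 5/12} or its complement is comeager.  In the first case there
   is a complementary pair in this set, and 2 * 5/12 < 1; in the second case there
   is a partition into three sets avoiding it, and 3 * 5/12 > 1. *)

Require Import Defs.
From HB Require Import structures.
From mathcomp Require Import all_boot all_order all_algebra.
From mathcomp Require Import all_classical all_reals all_analysis.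
From mathcomp Require Import measurable_realfun ring lra.
Import Order.TTheory GRing.Theory Num.Theory.
Import numFieldNormedType.Exports.

Set Implicit Arguments.
Unset Strict Implicit.
Unset Printing Implicit Defensive.

Local Open Scope classical_set_scope.
Local Open Scope ring_scope.

(** * Baire category on the Cantor space *)

(* [D n] stands for the open set of all x with a finite initial segment in [D n];
   the first condition says that this open set is dense. *)
Definition comeager (G : set (nat -> bool)) : Prop :=
  exists D : nat -> set (seq bool),
    (forall n s, exists t, D n (s ++ t)) /\
    (forall x, (forall n, exists k, D n (mkseq x k)) -> G x).

Lemma mkseq_eqP (T : Type) (x y : nat -> T) k :
  mkseq x k = mkseq y k <-> (forall m, m < k -> x m = y m)%N.
Proof.
split=> [xy m mk|xy].
  by rewrite -(nth_mkseq (x 0) x mk) xy nth_mkseq.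
by apply/eq_in_map => m; rewrite mem_iota => /xy.
Qed.

(** Used to shrink a cylinder into a neighbourhood of one of its points: appending the next k values
    of x makes the word at least k long. *)
Lemma mkseq_refine (x : nat -> bool) (s : seq bool) k :
  mkseq x (size s) = s -> exists t, forall y,
    mkseq y (size (s ++ t)) = s ++ t -> mkseq y k = mkseq x k.
Proof.
move=> sx; exists (mkseq (fun m => x (m + size s)%N) k) => y ys.
apply/mkseq_eqP => m mk.
have -> : x m = nth false (s ++ mkseq (fun m => x (m + size s)%N) k) m.
  rewrite nth_cat; case: ltnP => ms; first by rewrite -[in RHS]sx nth_mkseq.
  by rewrite nth_mkseq ?subnK// (leq_ltn_trans (leq_subr _ _) mk).
rewrite -ys nth_mkseq// size_cat size_mkseq.
by rewrite (leq_trans mk) ?leq_addl.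
Qed.

Lemma comeager_sub (G H : set (nat -> bool)) :
  G `<=` H -> comeager G -> comeager H.
Proof. by move=> GH [D [Dd DG]]; exists D; split=> // x /DG/GH. Qed.

Lemma comeager_bigcap (G : nat -> set (nat -> bool)) :
  (forall n, comeager (G n)) -> comeager (\bigcap_n G n).
Proof.
move=> /choice[D DG].
(* The default pair is harmless: it only repeats the requirement coded by (0, 0). *)
pose dec n := odflt (0, 0)%N (unpickle n).
exists (fun n => D (dec n).1 (dec n).2); split=> [n s|x xD n _].
  exact: (DG (dec n).1).1.
apply: (DG n).2 => m; have [k] := xD (pickle (n, m)).
by rewrite /dec pickleK => Dk; exists k.
Qed.

Lemma comeagerI (G H : set (nat -> bool)) :
  comeager G -> comeager H -> comeager (G `&` H).
Proof.
move=> cG cH; pose F n := if n is 0%N then G else H.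
suff /comeager_sub : \bigcap_n F n `<=` G `&` H.
  by apply; apply: comeager_bigcap => -[].
by move=> x Fx; split; [exact: (Fx 0%N)|exact: (Fx 1%N)].
Qed.

Lemma comeager_dense_open (D : set (seq bool)) :
  (forall s, exists t, D (s ++ t)) -> comeager [set x | exists k, D (mkseq x k)].
Proof. by move=> dD; exists (fun=> D); split=> // x /(_ 0%N). Qed.

(** A Baire category construction on words over T: stage n, coding (i, m), extends the current word
    so that its image under [v i] enters the m-th dense open set. Surjectivity of [v i] lifts the
    required bits to letters. *)
Lemma comeager_generic (T : Type) (G : set (nat -> bool)) (v : nat -> T -> bool) :
  comeager G -> (forall i b, exists a, v i a = b) ->
  exists t : nat -> T, forall i, G (v i \o t).
Proof.
move=> [D [Dd DG]] sv.
have [a0 _] := sv 0%N true.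
have lift_seq i (u : seq bool) : exists w : seq T, map (v i) w = u.
  elim: u => [|b u [w <-]]; first by exists [::].
  by have [a <-] := sv i b; exists (a :: w).
have step (p : seq T * nat) : exists w : seq T, (0 < size w)%N /\
    D (odflt (0, 0)%N (unpickle p.2)).2
      (map (v (odflt (0, 0)%N (unpickle p.2)).1) (p.1 ++ w)).
  case: p => s n /=; set i := (odflt _ _).1; set m := (odflt _ _).2.
  (* Appending [a0] first makes every extension nonempty, so the words grow to an infinite
     sequence. *)
  have [u Du] := Dd m (map (v i) (rcons s a0)).
  have [w wu] := lift_seq i u.
  exists (a0 :: w); split=> //.
  by rewrite -cat_rcons map_cat wu.
have {step}[e eP] := choice step.
pose s := fix s n := if n is n'.+1 then s n' ++ e (s n', n') else [::].
have s_size n : (n <= size (s n))%N.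
  elim: n => //= n IH; rewrite size_cat -addn1 leq_add//.
  by have [] := eP (s n, n).
have s_prefix n m : exists w, s (n + m)%N = s n ++ w.
  elim: m => [|m [w IH]]; first by exists [::]; rewrite addn0 cats0.
  by rewrite addnS /= IH -catA; eexists.
pose t m := nth a0 (s m.+1) m.
have st n : mkseq t (size (s n)) = s n.
  apply: (@eq_from_nth _ a0); rewrite size_mkseq// => j jn.
  rewrite nth_mkseq// /t; have [nj|jn'] := leqP n j.+1.
    have [w] := s_prefix n (j.+1 - n)%N; rewrite subnKC// => ->.
    by rewrite nth_cat jn.
  have [w] := s_prefix j.+1 (n - j.+1)%N; rewrite subnKC ?(ltnW jn')// => ->.
  by rewrite nth_cat s_size.
exists t => i; apply: DG => m; pose n := pickle (i, m).
exists (size (s n.+1)).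
rewrite /mkseq map_comp -/(mkseq t _) st /=.
by have [_] := eP (s n, n); rewrite /= pickleK.
Qed.

(* Stated as: the indicator function of A is continuous on a comeager set.  In this
   form stability under countable unions only needs one more dense open set. *)
Definition baire_property (A : set (nat -> bool)) : Prop :=
  exists G, comeager G /\ forall x, G x ->
    exists k, forall y, G y -> mkseq y k = mkseq x k -> (A y <-> A x).

Lemma baire_propertyC (A : set (nat -> bool)) :
  baire_property A -> baire_property (~` A).
Proof.
move=> [G [cG GA]]; exists G; split=> // x /GA[k kA].
by exists k => y Gy yx; rewrite /setC /=; have := kA y Gy yx; tauto.
Qed.

(** The cylinders deciding A within G form a dense open set; on its intersection with G the
    indicator function of A is locally constant. *)
Lemma baire_property_decided (A : set (nat -> bool)) (G : set (nat -> bool)) :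
  comeager G ->
  (forall s, exists t,
    (forall y, G y -> mkseq y (size (s ++ t)) = s ++ t -> A y) \/
    (forall y, G y -> mkseq y (size (s ++ t)) = s ++ t -> ~ A y)) ->
  baire_property A.
Proof.
move=> cG dA.
pose D (s : seq bool) := (forall y, G y -> mkseq y (size s) = s -> A y) \/
  (forall y, G y -> mkseq y (size s) = s -> ~ A y).
exists (G `&` [set x | exists k, D (mkseq x k)]); split.
  by apply: comeagerI => //; exact: comeager_dense_open.
move=> x [Gx [k]]; rewrite /D size_mkseq => Dk.
exists k => y [Gy _] yx; case: Dk => DA; have := DA _ Gx; have := DA _ Gy; tauto.
Qed.

(** Each cylinder either misses the union within the comeager set or contains a point of it in some
    [A n]; continuity at that point yields a smaller cylinder deciding the union. *)
Lemma baire_property_bigcup (A : nat -> set (nat -> bool)) :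
  (forall n, baire_property (A n)) -> baire_property (\bigcup_n A n).
Proof.
move=> /choice[G GA].
have cG : comeager (\bigcap_n G n) by apply: comeager_bigcap => n; case: (GA n).
apply: (baire_property_decided cG) => s.
have [[x [Gx sx [n _ Anx]]]|noA] := pselect (exists x,
    [/\ (\bigcap_n G n) x, mkseq x (size s) = s & (\bigcup_n A n) x]); last first.
  by exists [::]; right=> y Gy; rewrite cats0 => ys Ay; apply: noA; exists y.
have [k kA] := (GA n).2 _ (Gx n I).
have [t tk] := mkseq_refine k sx.
by exists t; left=> y Gy ys; exists n => //; apply/(kA y (Gy n I)) => //; exact: tk.
Qed.

Lemma baire_property_open (U : set (nat -> bool)) :
  (forall x, U x -> exists k, forall y, mkseq y k = mkseq x k -> U y) ->
  baire_property U.
Proof.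
move=> oU; apply: (@baire_property_decided _ setT).
  by exists (fun=> setT); split=> // _ s; exists [::].
move=> s; have [[x [sx Ux]]|noU] := pselect (exists x, mkseq x (size s) = s /\ U x);
  last by exists [::]; right=> y _; rewrite cats0 => ys Uy; apply: noU; exists y.
have [k kU] := oU x Ux.
have [t tk] := mkseq_refine k sx.
by exists t; left=> y _ ys; apply: kU; exact: tk.
Qed.

(** If no cylinder has its part of G inside A, continuity on G makes A and G disjoint. Otherwise let
    s be such a cylinder: overwriting an initial segment by s moves every point into it without
    affecting membership in A, and the preimage of G under this map is comeager. *)
Lemma baire_zero_one (A : set (nat -> bool)) :
  baire_property A ->
  (forall x y k, (forall m, (k <= m)%N -> x m = y m) -> A x -> A y) ->
  comeager A \/ comeager (~` A).
Proof.
move=> [G [cG GA]] tA.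
have [[s sA]|noA] := pselect (exists s, forall y, G y -> mkseq y (size s) = s -> A y);
  last first.
  right; apply: comeager_sub cG => x Gx Ax; have [k kA] := GA x Gx.
  apply: noA; exists (mkseq x k) => y Gy; rewrite size_mkseq => yx.
  by apply/kA.
left; have [D [Dd DG]] := cG.
pose graft x m := if (m < size s)%N then nth false s m else x m.
apply: (@comeager_sub [set x | G (graft x)]) => [x Gx|].
  apply: (tA (graft x) x (size s)) => [m|]; first by rewrite /graft ltnNge => ->.
  apply: sA => //; apply: (@eq_from_nth _ false); rewrite size_mkseq// => j js.
  by rewrite nth_mkseq// /graft js.
exists (fun n u => (size s <= size u)%N /\ D n (s ++ drop (size s) u)); split.
  (* Padding makes the word at least as long as s, so that the extension found by density lies
     beyond the overwritten segment. *)
  move=> n u; pose u' := u ++ nseq (size s) false.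
  have [t Dt] := Dd n (s ++ drop (size s) u').
  exists (nseq (size s) false ++ t); rewrite catA -/u'.
  have su : (size s <= size u')%N by rewrite size_cat size_nseq leq_addl.
  split; first by rewrite size_cat (leq_trans su) ?leq_addr.
  rewrite drop_cat; move: su; rewrite leq_eqVlt => /orP[/eqP su|su].
    by rewrite -su ltnn subnn drop0; rewrite su drop_size cats0 in Dt.
  by rewrite su catA.
move=> x xD; apply: DG => n; have [k [sk Dk]] := xD n; exists k.
rewrite size_mkseq in sk; suff -> : mkseq (graft x) k =
  s ++ drop (size s) (mkseq x k) by [].
apply: (@eq_from_nth _ false); first by rewrite size_cat size_drop !size_mkseq subnKC.
rewrite size_mkseq => j jk; rewrite nth_mkseq// nth_cat /graft.
case: ltnP => // sj; rewrite nth_drop subnKC// nth_mkseq//.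
Qed.

(** * Standard Borel structures *)

(** A separate name to carry the metric; the parameter fixes the field in which distances are
    taken. *)
Definition cantor (R : realType) : Type := nat -> bool.

HB.instance Definition _ (R : realType) := Pointed.on (cantor R).

Definition cantor_dist (R : realType) (x y : cantor R) : R :=
  if pselect (exists m, x m != y m) is left e then (ex_minn e).+1%:R^-1 else 0.

Lemma cantor_dist_ge (R : realType) (x y : cantor R) m :
  x m != y m -> m.+1%:R^-1 <= cantor_dist x y.
Proof.
rewrite /cantor_dist; case: pselect => [e|ne xy]; last by case: ne; exists m.
by case: ex_minnP => n _ nmin /nmin nm; rewrite lef_pV2 ?posrE// ler_nat.
Qed.

(** With [cantor_dist_ge], this presents a nonzero distance as the maximum of 1/(m+1) over the
    differing coordinates m; the metric axioms follow from these two facts. *)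
Lemma cantor_dist_witness (R : realType) (x y : cantor R) :
  cantor_dist x y = 0 /\ x = y \/
  exists m, x m != y m /\ cantor_dist x y = m.+1%:R^-1.
Proof.
rewrite /cantor_dist; case: pselect => [e|ne]; [right|left].
  by case: ex_minnP => n xy _; exists n.
by split=> //; apply/funext => m; apply: contrapT => /eqP xy; apply: ne; exists m.
Qed.

Lemma cantor_distxx (R : realType) (x : cantor R) : cantor_dist x x = 0.
Proof. by case: (cantor_dist_witness x x) => [[]|[m []]] //; rewrite eqxx. Qed.

Lemma cantor_dist_positivity (R : realType) (x y : cantor R) :
  cantor_dist x y = 0 -> x = y.
Proof.
case: (cantor_dist_witness x y) => [[]|[m [_ ->]]] // /eqP.
by rewrite invr_eq0 pnatr_eq0.
Qed.

Lemma cantor_dist_sym (R : realType) (x y : cantor R) :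
  cantor_dist x y = cantor_dist y x.
Proof.
wlog suff : x y / cantor_dist x y <= cantor_dist y x.
  by move=> le; apply/eqP; rewrite eq_le !le.
case: (cantor_dist_witness x y) => [[_ ->//]|[m [xy ->]]].
by rewrite cantor_dist_ge// eq_sym.
Qed.

Lemma cantor_dist_ge0 (R : realType) (x y : cantor R) : 0 <= cantor_dist x y.
Proof.
by case: (cantor_dist_witness x y) => [[->]|[m [_ ->]]] //; rewrite invr_ge0.
Qed.

Lemma cantor_dist_triangle (R : realType) (y x z : cantor R) :
  cantor_dist x z <= cantor_dist x y + cantor_dist y z.
Proof.
case: (cantor_dist_witness x z) => [[-> _]|[m [xz ->]]].
  by rewrite addr_ge0// cantor_dist_ge0.
have [xy|yz] : x m != y m \/ y m != z m.
  by move: xz; case: (x m) (y m) (z m) => [] [] []; auto.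
- by rewrite (le_trans (cantor_dist_ge xy))// lerDl cantor_dist_ge0.
- by rewrite (le_trans (cantor_dist_ge yz))// lerDr cantor_dist_ge0.
Qed.

HB.instance Definition _ (R : realType) := @isMetric.Build R (cantor R)
  (@cantor_dist R) (@cantor_distxx R) (@cantor_dist_positivity R)
  (@cantor_dist_sym R) (@cantor_dist_triangle R).

Lemma cantor_dist_lt (R : realType) (x y : cantor R) k :
  (cantor_dist x y < k.+1%:R^-1) <-> mkseq y k.+1 = mkseq x k.+1.
Proof.
split=> [xyk|/mkseq_eqP yx].
  apply/mkseq_eqP => m mk; apply/eqP; rewrite eq_sym; apply: contraLR xyk => xy.
  rewrite -leNgt (le_trans _ (cantor_dist_ge xy))//.
  by rewrite lef_pV2 ?posrE// ler_nat.
case: (cantor_dist_witness x y) => [[-> _]|[m [xy ->]]].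
  by rewrite invr_gt0.
rewrite ltf_pV2 ?posrE// ltr_nat !ltnS ltnNge.
by apply: contraNN xy => mk; rewrite yx// ltnS.
Qed.

(** Links the metric topology to the cylinders in which [baire_property] is phrased. *)
Lemma cantor_nbhsP (R : realType) (x : cantor R) (U : set (cantor R)) :
  nbhs x U <-> exists k, forall y : cantor R, mkseq y k = mkseq x k -> U y.
Proof.
split=> [/nbhs_ballP[e /= e0 xU]|[k xU]]; last apply/nbhs_ballP.
  have [k ke] : exists k, k.+1%:R^-1 < e.
    exists (Num.truncn e^-1); rewrite -[ltRHS]invrK ltf_pV2 ?posrE ?invr_gt0//.
    exact: truncnS_gt.
  exists k.+1 => y /cantor_dist_lt yx; apply: xU; rewrite ballEmdist/=.
  exact: lt_trans ke.
exists k.+1%:R^-1 => [/=|y]; first by rewrite invr_gt0.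
rewrite ballEmdist/= => /cantor_dist_lt/mkseq_eqP yx; apply: xU.
by apply/mkseq_eqP => m mk; apply: yx; exact: leqW.
Qed.

Lemma cantor_openP (R : realType) (U : set (cantor R)) :
  open U <-> forall x, U x -> exists k, forall y : cantor R, mkseq y k = mkseq x k -> U y.
Proof.
rewrite openE; split=> oU x Ux; first exact/cantor_nbhsP/oU.
exact/cantor_nbhsP/oU.
Qed.

Lemma cantor_complete (R : realType) : complete_metric (cantor R).
Proof.
move=> u /cauchy_ballP cu.
have /choice[N uN] k : exists N, forall n, (N <= n)%N -> mkseq (u n) k.+1 = mkseq (u N) k.+1.
  have [|[A B] /= [[N1 _ NA] [N2 _ NB]] AB] := cu k.+1%:R^-1 _.
    by rewrite invr_gt0.
  exists (maxn N1 N2) => n Nn.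
  have := AB (u (maxn N1 N2), u n); rewrite /= ballEmdist /= => /(_ _)/cantor_dist_lt-> //.
  split; first by apply: NA => /=; rewrite leq_maxl.
  by apply: NB => /=; rewrite (leq_trans _ Nn)// leq_maxr.
(* Diagonal limit: coordinate m no longer changes from index [N m] on. *)
exists (fun m => u (N m) m); move=> U /cantor_nbhsP[k kU].
exists (\max_(j < k) N j)%N => // n /= Nn; apply: kU; apply/mkseq_eqP => m mk.
have /mkseq_eqP -> // : mkseq (u n) m.+1 = mkseq (u (N m)) m.+1.
by apply: uN; apply: leq_trans Nn; exact: (@leq_bigmax _ (fun j : 'I_k => N j) (Ordinal mk)).
Qed.

Lemma cantor_separable (R : realType) : separable (cantor R).
Proof.
(* The eventually false sequences: [nth false] continues a finite word by false. *)
exists (range (nth false : seq bool -> cantor R)).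
  exact: (sub_countable (card_image_le _ _) (countableP _)).
move=> U [x Ux] /cantor_openP oU; have [k kU] := oU x Ux.
exists (nth false (mkseq x k)); split; last by exists (mkseq x k).
by apply: kU; apply/mkseq_eqP => m mk; rewrite nth_mkseq.
Qed.

Definition cantor_borel (R : realType) := g_sigma_algebraType (@open (cantor R)).

Lemma standard_borel_cantor (R : realType) : standard_borel R (cantor_borel R).
Proof.
exists (cantor R), id; split; [exact: cantor_complete|exact: cantor_separable| |].
  by exists id.
by move=> A; rewrite image_id.
Qed.

(** The sets with the Baire property form a sigma-algebra containing the open sets. *)
Lemma cantor_measurable_baire (R : realType) (A : set (cantor_borel R)) :
  measurable A -> baire_property A.
Proof.
apply: smallest_sub => [|U /cantor_openP oU]; last exact: baire_property_open.
split.
- by apply: baire_property_open => x [].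
- by move=> B bB; rewrite setTD; exact: baire_propertyC.
- by move=> F bF; exact: baire_property_bigcup.
Qed.

Lemma measurable_cantor_coordinate (R : realType) m :
  measurable [set x : cantor_borel R | x m].
Proof.
apply: sub_sigma_algebra; apply/cantor_openP => x /= xm.
by exists m.+1 => y /mkseq_eqP ->.
Qed.

Lemma countType_bigcup_measurable d (T : measurableType d) (I : countType)
    (P : set I) (F : I -> set T) :
  (forall i, P i -> measurable (F i)) -> measurable (\bigcup_(i in P) F i).
Proof.
move=> mF; rewrite bigcup_mkcond.
apply: countable_bigcupT_measurable => [|i]; first exact: countableP.
by case: ifP => //; rewrite inE; exact: mF.
Qed.

Lemma countType_bigcap_measurable d (T : measurableType d) (I : countType)
    (P : set I) (F : I -> set T) :
  (forall i, P i -> measurable (F i)) -> measurable (\bigcap_(i in P) F i).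
Proof.
move=> mF; rewrite -[X in measurable X]setCK setC_bigcap; apply: measurableC.
by apply: countType_bigcup_measurable => i /mF/measurableC.
Qed.

(** An open set is a countable union of cylinders, and each cylinder constrains finitely many
    coordinates. *)
Lemma measurable_cantor_map (R : realType) d (T : measurableType d)
    (f : T -> cantor_borel R) :
  (forall m, measurable [set t | f t m]) -> measurable_fun setT f.
Proof.
move=> mf.
apply: (measurability (@open (cantor R) : set (set (cantor_borel R)))) => // _ [U /cantor_openP oU <-].
rewrite setTI.
pose C (s : seq bool) : set T := [set t | mkseq (f t) (size s) = s].
have mC s : measurable (C s).
  have -> : C s = \bigcap_(m in [set m | (m < size s)%N])
      (if nth false s m then [set t | f t m] else ~` [set t | f t m]).
    apply/seteqP; split=> t /= Ct.
      move=> m /= ms; rewrite -[X in nth _ X _]Ct nth_mkseq//; case: ifPn => //= /negP.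
      by [].
    apply: (@eq_from_nth _ false); rewrite size_mkseq// => j js.
    rewrite nth_mkseq//; have := Ct j js; case: nth => //= /negP.
    exact: negbTE.
  apply: bigcap_measurableType => m _; case: nth => //.
  exact: measurableC.
have -> : f @^-1` U = \bigcup_(s in [set s | forall y : cantor R, mkseq y (size s) = s -> U y]) C s.
  apply/seteqP; split=> t /=; last by case=> s /= sU Ct; exact: sU.
  move=> Uft; have [k kU] := oU _ Uft.
  by exists (mkseq (f t) k); rewrite /C/= ?size_mkseq.
exact: countType_bigcup_measurable.
Qed.

Definition two (R : realType) : Type := bool.

HB.instance Definition _ (R : realType) := Choice.on (two R).

Definition two_dist (R : realType) (x y : two R) : R := (x != y)%:R.

Lemma two_distxx (R : realType) (x : two R) : two_dist x x = 0.
Proof. by rewrite /two_dist eqxx. Qed.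

Lemma two_dist_positivity (R : realType) (x y : two R) :
  two_dist x y = 0 -> x = y.
Proof. by rewrite /two_dist; case: eqP => // _ /eqP; rewrite oner_eq0. Qed.

Lemma two_dist_sym (R : realType) (x y : two R) : two_dist x y = two_dist y x.
Proof. by rewrite /two_dist eq_sym. Qed.

Lemma two_dist_triangle (R : realType) (y x z : two R) :
  two_dist x z <= two_dist x y + two_dist y z.
Proof.
rewrite /two_dist -natrD ler_nat.
by case: x y z => [] [] [].
Qed.

HB.instance Definition _ (R : realType) := @isMetric.Build R (two R)
  (@two_dist R) (@two_distxx R) (@two_dist_positivity R)
  (@two_dist_sym R) (@two_dist_triangle R).

Lemma two_nbhs (R : realType) (x : two R) (U : set (two R)) : U x -> nbhs x U.
Proof.
move=> Ux; apply/nbhs_ballP; exists 1 => //= y.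
rewrite ballEmdist /= /mdist /= /two_dist; case: eqP => [<-//|_].
by rewrite ltxx.
Qed.

Lemma standard_borel_bool (R : realType) : standard_borel R bool.
Proof.
exists (two R), id; split.
(* In the discrete metric, radius 1 already forces a Cauchy sequence to be eventually constant. *)
- move=> u /cauchy_ballP /(_ 1 ltr01)[[A B] /= [[N1 _ NA] [N2 _ NB]] AB].
  exists (u (maxn N1 N2)) => U /nbhs_singleton Uu.
  exists (maxn N1 N2) => // n /= Nn.
  have := AB (u (maxn N1 N2), u n); rewrite /= ballEmdist /= /mdist /= /two_dist.
  case: eqP => [<-//|_]; rewrite ltxx => abs; exfalso; suff: false by []; apply: abs.
  split; first by apply: NA => /=; rewrite leq_maxl.
  by apply: NB => /=; rewrite (leq_trans _ Nn)// leq_maxr.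
- exists setT; first exact: countableP.
  by move=> U [x Ux] _; exists x.
- by exists id.
- move=> A; rewrite image_id; split=> // _.
  by apply: sub_sigma_algebra; rewrite openE => x; exact: two_nbhs.
Qed.

(** * Almost norm-minimal convex combinations *)

(* Iterated midpoints suffice for the L^2 argument below and, unlike general convex
   combinations, are indexed by a countable type. *)
Inductive midtree : Type := Leaf of nat | Mid of midtree & midtree.

(** Gives the countable structure on which the first-choice rule and the measurability of the choice
    rest. *)
Fixpoint midtree_encode (w : midtree) : GenTree.tree nat :=
  match w with
  | Leaf n => GenTree.Leaf n
  | Mid a b => GenTree.Node 0 [:: midtree_encode a; midtree_encode b]
  end.

Fixpoint midtree_decode (t : GenTree.tree nat) : option midtree :=
  match t with
  | GenTree.Leaf n => Some (Leaf n)
  | GenTree.Node _ [:: a; b] =>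
      if (midtree_decode a, midtree_decode b) is (Some a', Some b')
      then Some (Mid a' b') else None
  | _ => None
  end.

Lemma midtree_encodeK : pcancel midtree_encode midtree_decode.
Proof. by elim=> //= a -> b ->. Qed.

HB.instance Definition _ := Countable.copy midtree (pcan_type midtree_encodeK).

Fixpoint leaves_ge (n : nat) (w : midtree) : bool :=
  match w with
  | Leaf m => (n <= m)%N
  | Mid a b => leaves_ge n a && leaves_ge n b
  end.

Lemma leaves_ge_trans m n w : (m <= n)%N -> leaves_ge n w -> leaves_ge m w.
Proof.
move=> mn; elim: w => /= [k|a IHa b IHb]; first exact: leq_trans.
by move=> /andP[/IHa -> /IHb ->].
Qed.

Fixpoint midtree_eval (R : realType) (X : Type) (c : nat -> X -> R) (w : midtree)
    (x : X) : R :=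
  match w with
  | Leaf m => c m x
  | Mid a b => (midtree_eval c a x + midtree_eval c b x) / 2
  end.

Lemma midtree_eval01 (R : realType) (X : Type) (c : nat -> X -> R) w x :
  (forall m x, 0 <= c m x <= 1) -> 0 <= midtree_eval c w x <= 1.
Proof. by move=> c01; elim: w => //= a IHa b IHb; lra. Qed.

(** The equation is affine, so its solutions are closed under midpoints. *)
Lemma midtree_eval_sum (R : realType) (X : Type) (c : nat -> X -> R) k
    (x : nat -> X) (e : R) N w :
  (forall m, (N <= m)%N -> \sum_(i < k) c m (x i) = e) -> leaves_ge N w ->
  \sum_(i < k) midtree_eval c w (x i) = e.
Proof.
move=> ce; elim: w => /= [m|a IHa b IHb]; first exact: ce.
move=> /andP[/IHa ea /IHb eb].
by rewrite -mulr_suml big_split /= ea eb; field.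
Qed.

Lemma measurable_midtree_eval (R : realType) d (X : measurableType d)
    (c : nat -> X -> R) w :
  (forall m, measurable_fun setT (c m)) -> measurable_fun setT (midtree_eval c w).
Proof.
move=> mc; elim: w => //= a IHa b IHb.
by apply: measurable_funM => //; exact: measurable_funD.
Qed.

(* [nu] is the squared norm and [p.1] a lower bound on the indices occurring in
   [p.2].  The last condition makes [nu p.2] almost the supremum over l of the
   infimum over the l-th tail, so that near minimizers of different tails are close. *)
Definition near_min (R : realType) (nu : midtree -> R) (eps : R) (p : nat * midtree) :=
  [/\ leaves_ge p.1 p.2,
      forall v, leaves_ge p.1 v -> nu p.2 <= nu v + eps &
      forall l, exists2 v, leaves_ge l v & nu v <= nu p.2 + eps].

(** The infima over the tails increase and stay below B. Half of eps is spent on a tail whose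
    infimum is close to their supremum, half on an element close to that infimum. *)
Lemma near_min_exists (R : realType) (nu : midtree -> R) (B eps : R) k :
  (forall w, 0 <= nu w <= B) -> 0 < eps ->
  exists p, (k <= p.1)%N /\ near_min nu eps p.
Proof.
move=> nuB e0.
have e2 : 0 < eps / 2 by lra.
pose V n : set R := [set nu w | w in [set w | leaves_ge n w]].
have V0 n : V n !=set0 by exists (nu (Leaf n)), (Leaf n) => //=.
have Vlb n : has_lbound (V n) by exists 0 => _ [w _ <-]; case/andP: (nuB w).
have infV n w : leaves_ge n w -> inf (V n) <= nu w.
  by move=> nw; apply: ge_inf => //; exists w.
have appr n : exists2 w, leaves_ge n w & nu w <= inf (V n) + eps / 2.
  have [_ [w nw <-] /ltW wlt] := inf_adherent e2 (conj (V0 n) (Vlb n)).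
  by exists w.
pose D := range (fun n => inf (V n)).
have Dub : has_ubound D.
  exists B => _ [n _ <-]; have [w nw _] := appr n.
  by rewrite (le_trans (infV n w nw))//; case/andP: (nuB w).
have D0 : D !=set0 by exists (inf (V 0%N)), 0%N.
have [_ [n0 _ <-] n0D] := sup_adherent e2 (conj D0 Dub).
have infV_nd m n : (m <= n)%N -> inf (V m) <= inf (V n).
  move=> mn; apply: lb_le_inf => // _ [w nw <-]; apply: infV.
  exact: leaves_ge_trans nw.
pose n := maxn k n0.
have nD l : inf (V l) <= inf (V n) + eps / 2.
  have : inf (V l) <= sup D by apply: ub_le_sup => //; exists l.
  by have := infV_nd n0 n (leq_maxr _ _); move: n0D; lra.
have [w nw wn] := appr n.
exists (n, w); split; first exact: leq_maxl.
split=> //= [v nv|l]; first by have := infV n v nv; lra.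
have [v lv vl] := appr l; exists v => //.
by have := nD l; have := infV n w nw; lra.
Qed.

(* Parallelogram law: the left-hand side is the squared distance of p.2 and p'.2. *)
Lemma near_min_close (R : realType) (nu : midtree -> R) (eps eps' : R) p p' :
  eps' <= eps -> near_min nu eps p -> near_min nu eps' p' ->
  2 * nu p.2 + 2 * nu p'.2 - 4 * nu (Mid p.2 p'.2) <= 8 * eps.
Proof.
move=> ee [w1 w2 w3] [w1' w2' w3'].
have [nn|/ltnW nn] := leqP p.1 p'.1.
  (* The midpoint competes in the earlier tail, so [nu p.2] is at most its norm plus eps; passing
     through v, [nu p'.2] is at most [nu p.2] plus 2 eps. Together these give 8 eps. *)
  have mid : leaves_ge p.1 (Mid p.2 p'.2).
    by rewrite /= w1 (leaves_ge_trans nn).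
  have := w2 _ mid; have [v /w2'] := w3 p'.1; lra.
have mid : leaves_ge p'.1 (Mid p.2 p'.2) by rewrite /= w1' (leaves_ge_trans nn).
have := w2' _ mid; have [v /w2] := w3' p.1; lra.
Qed.

Lemma sum_half_powers (R : realType) n :
  \sum_(j < n) (2 ^- j : R) <= 2 - 2 * 2 ^- n.
Proof.
elim: n => [|n IH]; first by rewrite big_ord0 expr0 invr1 mulr1 subrr.
rewrite big_ord_recr /=; have -> : 2 ^- n.+1 = 2 ^- n / 2 :> R.
  by rewrite exprS invfM mulrC.
lra.
Qed.

(** The weights make the increments absolutely summable: the total variation is at most B + 2, where
    2 bounds the geometric sum. *)
Lemma cvg_of_square_summable (R : realType) (u : nat -> R) (B : R) :
  (forall n, \sum_(j < n) 2 ^+ j * (u j.+1 - u j) ^+ 2 <= B) -> cvgn u.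
Proof.
move=> uB.
(* AM-GM, to bound the total variation by the weighted sum of squares *)
have amgm j : `|u j.+1 - u j| <= 2 ^+ j * (u j.+1 - u j) ^+ 2 + 2 ^- j.
  set x := u j.+1 - u j; have p0 : 0 < 2 ^+ j :> R by rewrite exprn_gt0.
  rewrite -(ler_pM2l p0) mulrDr divff ?gt_eqF// mulrA -expr2 -exprMn.
  rewrite -[X in X * `|x|]ger0_norm ?(ltW p0)// -normrM -[X in _ <= X + 1]real_normK ?num_real//.
  by have := sqr_ge0 (`|2 ^+ j * x| - 1); have := normr_ge0 (2 ^+ j * x); nra.
have cs : cvgn (series (telescope u)).
  apply: normed_cvg; apply: nondecreasing_is_cvgn.
    by apply: nondecreasing_series => n _ _; exact: normr_ge0.
  exists (B + 2) => _ [n _ <-]; change (\sum_(0 <= j < n) `|u j.+1 - u j| <= B + 2); rewrite big_mkord.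
  apply: (le_trans (ler_sum _ (fun (i : 'I_n) _ => amgm i))); rewrite big_split /=.
  have := uB n; have := sum_half_powers R n; have : 0 <= 2 ^- n :> R by rewrite invr_ge0 exprn_ge0.
  lra.
have -> : u = (fun n => series (telescope u) n + u 0%N).
  by apply/funext => n; rewrite telescopeK subrK.
by apply: is_cvgD => //; exact: is_cvg_cst.
Qed.

(** * Solving the equations almost everywhere, measurably in the prior *)

(** Choose the index of least code: the level set at i is [Q i] minus the [Q i'] of smaller code. *)
Lemma measurable_first_choice d (Z : measurableType d) (I : countType)
    (Q : I -> set Z) :
  (forall i, measurable (Q i)) -> (forall z, exists i, Q i z) ->
  exists s : Z -> I, (forall z, Q (s z) z) /\ forall i, measurable [set z | s z = i].
Proof.
move=> mQ Qz.
have /choice[s sP] z : exists i, Q i z /\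
    forall i', Q i' z -> (pickle i <= pickle i')%N.
  have ex : exists n, `[< exists2 i, pickle i = n & Q i z >].
    by have [i Qi] := Qz z; exists (pickle i); apply/asboolP; exists i.
  case: (ex_minnP ex) => n /asboolP[i <- Qi] imin; exists i; split=> // i' Qi'.
  by apply: imin; apply/asboolP; exists i'.
exists s; split=> [z|i]; first exact: (sP z).1.
have -> : [set z | s z = i] =
    Q i `&` \bigcap_(i' in [set i' | (pickle i' < pickle i)%N]) ~` Q i'.
  apply/seteqP; split=> z /=.
    move=> <-; split; first exact: (sP z).1.
    by move=> i' /= lt /(sP z).2; rewrite leqNgt lt.
  case=> Qi imin; apply: (pcan_inj pickleK); apply/eqP; rewrite eqn_leq.
  apply/andP; split; first exact: (sP z).2.
  rewrite leqNgt; apply/negP => /imin; apply.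
  exact: (sP z).1.
apply: measurableI => //; apply: countType_bigcap_measurable => i' _.
exact: measurableC.
Qed.

(** Joint measurability holds because s has countably many values: preimages are countable unions of
    rectangles. *)
Lemma measurable_fun_select d d' d'' (X : measurableType d) (Z : measurableType d')
    (Y : measurableType d'') (I : countType) (s : Z -> I) (F : I -> X -> Y) :
  (forall i, measurable [set z | s z = i]) ->
  (forall i, measurable_fun setT (F i)) ->
  measurable_fun setT (fun p : X * Z => F (s p.2) p.1).
Proof.
move=> ms mF _ B mB; rewrite setTI.
have -> : (fun p : X * Z => F (s p.2) p.1) @^-1` B =
    \bigcup_(i in [set: I]) ((F i @^-1` B) `*` [set z | s z = i]).
  apply/seteqP; split=> -[x z] /=; first by move=> Bx; exists (s z).
  by case=> i _ [/= Bx zi]; rewrite zi.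
apply: countType_bigcup_measurable => i _; apply: measurableX => //.
by rewrite -[X in measurable X]setTI; exact: mF.
Qed.

(** The identity on probability measures is a kernel, namely sampling, and integration against a
    kernel is measurable. *)
Lemma measurable_fun_pprobability_integral (R : realType) d (T : measurableType d)
    (h : T -> R) : measurable_fun setT h -> (forall t, 0 <= h t) ->
  measurable_fun setT
    (fun pi : pprobability T R => fine (\int[pi]_t (h t)%:E)%E).
Proof.
move=> mh h0; apply: (measurableT_comp (fine_measurable measurableT)).
apply: (@measurable_fun_integral_kernel _ _ (pprobability T R) T R
  (fun pi => pi)) => [U mU|t|].
- exact: (measurable_kernel (kprobability (@measurable_id _ (pprobability T R) setT)) U mU).
- by rewrite lee_fin.
- exact/measurable_EFinP.
Qed.

Lemma integral_probability_le (R : realType) d (T : measurableType d)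
    (P : probability T R) (h : T -> R) (B : R) :
  measurable_fun setT h -> (forall t, 0 <= h t) -> (forall t, h t <= B) ->
  (\int[P]_t (h t)%:E <= B%:E)%E.
Proof.
move=> mh h0 hB; rewrite (@le_trans _ _ (\int[P]_t B%:E)%E)//.
  apply: ge0_le_integral => //.
  - by move=> t _; rewrite lee_fin.
  - exact/measurable_EFinP.
  - by move=> t _; rewrite lee_fin.
by rewrite integral_cst//= probability_setT mule1.
Qed.

Lemma eventually_solvable_ae (R : realType) d d' (X : measurableType d)
    (Theta : measurableType d') (k : nat) (q : nat -> Theta -> X)
    (c : nat -> X -> R) (e : Theta -> R) :
  (forall i, measurable_fun setT (q i)) ->
  (forall m, measurable_fun setT (c m)) ->
  (forall m x, 0 <= c m x <= 1) ->
  (forall t, exists N, forall m, (N <= m)%N -> \sum_(i < k) c m (q i t) = e t) ->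
  exists C : X * pprobability Theta R -> R,
    [/\ measurable_fun setT C, forall z, 0 <= C z <= 1 &
        forall pi : pprobability Theta R,
          {ae pi, forall t, \sum_(i < k) C (q i t, pi) = e t}].
Proof.
move=> mq mc c01 ce.
pose W := midtree_eval c.
have W01 w x : 0 <= W w x <= 1 by exact: midtree_eval01.
have mW w : measurable_fun setT (W w) by exact: measurable_midtree_eval.
have mWq w i : measurable_fun setT (fun t => W w (q i t)).
  exact: (measurableT_comp (mW w) (mq i)).
(* The norm only looks at the points [q i t], the only ones where convergence is required. *)
pose h w t := \sum_(i < k) W w (q i t) ^+ 2.
have mh w : measurable_fun setT (h w).
  by apply: measurable_sum => i; exact: measurable_funX.
have h0 w t : 0 <= h w t by apply: sumr_ge0 => i _; exact: sqr_ge0.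
have hk w t : h w t <= k%:R.
  rewrite (@le_trans _ _ (\sum_(i < k) 1))//; last by rewrite sumr_const card_ord.
  by apply: ler_sum => i _; have := W01 w (q i t); nra.
pose J (pi : pprobability Theta R) w := (\int[pi]_t (h w t)%:E)%E.
have J0 pi w : (0 <= J pi w)%E by apply: integral_ge0 => t _; rewrite lee_fin.
have Jk pi w : (J pi w <= k%:R%:E)%E.
  exact: integral_probability_le.
have Jfin pi w : J pi w \is a fin_num.
  by rewrite ge0_fin_numE// (le_lt_trans (Jk pi w))// ltry.
pose nu pi w := fine (J pi w).
have nuk pi w : 0 <= nu pi w <= k%:R.
  by rewrite fine_ge0//= -lee_fin fineK.
have mnu w : measurable_fun setT (nu ^~ w).
  exact: measurable_fun_pprobability_integral.
(* Against the weights 2^j used below, 4^-j leaves the summable 2^-j. *)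
pose eps j : R := 4 ^- j.
have eps0 j : 0 < eps j by rewrite /eps invr_gt0 exprn_gt0.
pose Q j (p : nat * midtree) : set (pprobability Theta R) :=
  [set pi | (j <= p.1)%N /\ near_min (nu pi) (eps j) p].
have mQ j p : measurable (Q j p).
  have mle v w : measurable [set pi | nu pi v <= nu pi w + eps j].
    rewrite -[X in measurable X]setTI; apply: measurable_fun_le => //.
    exact: measurable_funD.
  (* Conditions free of the prior are settled by cases; the others quantify over countable types. *)
  have -> : Q j p = if (j <= p.1)%N && leaves_ge p.1 p.2 then
      (\bigcap_(v in [set v | leaves_ge p.1 v]) [set pi | nu pi p.2 <= nu pi v + eps j])
      `&` \bigcap_(l in [set: nat]) \bigcup_(v in [set v | leaves_ge l v])
            [set pi | nu pi v <= nu pi p.2 + eps j]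
    else set0.
    case: ifPn => [/andP[jp p12]|/nandP jp].
      apply/seteqP; split=> pi /=.
        move=> [_ [_ near1 near2]]; split=> // l _.
        by have [v lv vle] := near2 l; exists v.
      move=> [near1 near2]; split=> //; split=> // l.
      by have [v lv vle] := near2 l I; exists v.
    by apply/seteqP; split=> // pi [j1 [p1 _ _]]; case: jp; rewrite ?j1 ?p1.
  case: ifP => // _; apply: measurableI.
    by apply: countType_bigcap_measurable => v _.
  apply: countType_bigcap_measurable => l _.
  by apply: countType_bigcup_measurable => v _.
have Qex j pi : exists p, Q j p pi by exact: near_min_exists (nuk pi) (eps0 j).
have /choice[s sP] j := measurable_first_choice (mQ j) (Qex j).
pose F j (z : X * pprobability Theta R) := W (s j z.2).2 z.1.
have mF j : measurable_fun setT (F j).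
  exact: (measurable_fun_select (F := fun p => W p.2) (sP j).2).
(* The upper limit is measurable whether or not the sequence converges. Clamping keeps C in [0, 1]
   and leaves genuine limits unchanged. *)
pose C z := Num.max 0 (Num.min 1 (fine (limn_esup (fun j => (F j z)%:E)))).
exists C; split.
- apply: measurable_maxr => //; apply: measurable_minr => //.
  apply: (measurableT_comp (fine_measurable measurableT)).
  by apply: measurable_fun_limn_esup => j; exact/measurable_EFinP.
- move=> z; rewrite /C; set a := fine _; rewrite le_max lexx/= ge_max ler01/=.
  by rewrite ge_min lexx.
move=> pi.
pose w j := (s j pi).2.
pose D j t := \sum_(i < k) (W (w j.+1) (q i t) - W (w j) (q i t)) ^+ 2.
have mD j : measurable_fun setT (D j).
  apply: measurable_sum => i; apply: measurable_funX.
  exact: measurable_funB.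
have D0 j t : 0 <= D j t by apply: sumr_ge0 => i _; exact: sqr_ge0.
have intD j : (\int[pi]_t (D j t)%:E <= (8 * eps j)%:E)%E.
  pose m := Mid (w j) (w j.+1).
  (* The parallelogram law in additive form, so that only nonnegative functions are integrated. *)
  have par : ((\int[pi]_t (D j t)%:E) + 4%:E * J pi m =
      2%:E * J pi (w j) + 2%:E * J pi (w j.+1))%E.
    have mE f : measurable_fun setT f ->
        measurable_fun setT (fun t : Theta => (f t : R)%:E).
      by move=> ?; exact/measurable_EFinP.
    rewrite -!ge0_integralZl_EFin//; try by [move=> *; rewrite lee_fin|exact: mE].
    rewrite -!ge0_integralD//; try by
      [move=> *; rewrite lee_fin// mulr_ge0
      |exact: mE|apply: (mE (fun t => _ * h _ t)); exact: measurable_funM].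
    apply: eq_integral => t _; rewrite -!EFinM -!EFinD; congr EFin.
    rewrite /D /h /m !mulr_sumr -!big_split; apply: eq_bigr => i _.
    have -> : W (Mid (w j) (w j.+1)) (q i t) =
      (W (w j) (q i t) + W (w j.+1) (q i t)) / 2 by [].
    by rewrite /=; field.
  have eps_le : eps j.+1 <= eps j.
    by rewrite lef_pV2 ?posrE ?exprn_gt0// ler_eXn2l// ltr1n.
  have := near_min_close eps_le ((sP j).1 pi).2 ((sP j.+1).1 pi).2.
  rewrite -/(w j) -/(w j.+1) -/m -!lee_fin; apply: le_trans.
  have -> : (\int[pi]_t (D j t)%:E =
      2%:E * J pi (w j) + 2%:E * J pi (w j.+1) - 4%:E * J pi m)%E.
    by rewrite -par addeK// fin_numM//.
  rewrite -[J pi (w j)]fineK// -[J pi (w j.+1)]fineK// -[J pi m]fineK//.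
pose G t := (\sum_(0 <= j <oo) (2 ^+ j * D j t)%:E)%E.
have mG j : measurable_fun setT (fun t => (2 ^+ j * D j t)%:E).
  by apply/measurable_EFinP; exact: measurable_funM.
have G0 j t : (0 <= (2 ^+ j * D j t)%:E)%E by rewrite lee_fin mulr_ge0// exprn_ge0.
(* 16 is the sum of 2^j * 8 * 4^-j over all j. *)
have intG : (\int[pi]_t G t <= 16%:E)%E.
  rewrite integral_nneseries//; apply: lime_le.
    by apply: is_cvg_nneseries => n _ _; exact: integral_ge0.
  apply: nearW => n.
  rewrite (@le_trans _ _ (\sum_(0 <= j < n) (8 * 2 ^- j)%:E)%E)//.
    apply: lee_sum => j _.
    under eq_integral do rewrite EFinM.
    rewrite ge0_integralZl_EFin//; last first.
      exact/measurable_EFinP.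
      by move=> t _; rewrite lee_fin.
    have -> : (8 * 2 ^- j)%:E = ((2 ^+ j)%:E * (8 * eps j)%:E)%E :> \bar R.
      rewrite -EFinM; congr EFin; rewrite /eps (_ : 4 = 2 * 2)//; last by ring.
      by rewrite exprMn; field; rewrite expf_neq0.
    by apply: lee_wpmul2l; rewrite ?lee_fin ?exprn_ge0.
  rewrite sumEFin lee_fin -mulr_sumr.
  rewrite big_mkord; have := sum_half_powers R n.
  have : 0 <= 2 ^- n :> R by rewrite invr_ge0 exprn_ge0.
  lra.
have Gint : pi.-integrable setT G.
  apply/integrableP; split; first exact: ge0_emeasurable_sum.
  under eq_integral do rewrite gee0_abs ?nneseries_ge0//.
  by rewrite (le_lt_trans intG)// ltry.
(* Where G is finite, it bounds the weighted squares of the increments for every i at once. *)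
have := integrable_ae measurableT Gint; apply: filterS => t /(_ I) Gt.
have cv i : (i < k)%N -> cvgn (fun j => W (w j) (q i t)).
  move=> ik; apply: (@cvg_of_square_summable _ _ (fine (G t))) => n.
  rewrite -lee_fin fineK// -sumEFin.
  rewrite (@le_trans _ _ (\sum_(0 <= j < n) (2 ^+ j * D j t)%:E)%E)//.
    rewrite big_mkord; apply: lee_sum => j _; rewrite lee_fin.
    rewrite ler_pM2l ?exprn_gt0// /D (bigD1 (Ordinal ik))//= lerDl.
    by apply: sumr_ge0 => *; exact: sqr_ge0.
  by apply: nneseries_lim_ge.
have Clim i : (i < k)%N -> C (q i t, pi) = limn (fun j => W (w j) (q i t)).
  move=> ik; have cvi := cv i ik.
  have l0 : 0 <= limn (fun j => W (w j) (q i t)).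
    by apply: limr_ge => //; apply: nearW => j; case/andP: (W01 (w j) (q i t)).
  have l1 : limn (fun j => W (w j) (q i t)) <= 1.
    by apply: limr_le => //; apply: nearW => j; case/andP: (W01 (w j) (q i t)).
  rewrite /C (_ : fine _ = limn (fun j => W (w j) (q i t))).
    by rewrite (min_idPr l1) (max_idPr l0).
  have cvE : (W (w j) (q i t))%:E @[j --> \oo] -->
      (limn (fun j => W (w j) (q i t)))%:E.
    by apply: cvg_EFin => //; exact: nearW.
  by have [_ ->] := cvg_limn_einf_sup cvE.
have -> : \sum_(i < k) C (q i t, pi) =
    limn (fun j => \sum_(i < k) W (w j) (q i t)).
  apply/esym/cvg_lim => //; under [X in _ --> X]eq_bigr => i _ do rewrite Clim//.
  by apply: cvg_big => [|i _]; [exact: add_continuous|exact: cv].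
(* The leaves of [w j] are at least j, so the sums are constant from N on. *)
have [N ceN] := ce t.
apply/cvg_lim => //; apply: cvg_near_cst; exists N => // j /= Nj.
have [jp [jl _ _]] := (sP j).1 pi.
exact: (@midtree_eval_sum _ _ c k (fun i => q i t) _ _ _ ceN (leaves_ge_trans (leq_trans Nj jp) jl)).
Qed.

(** * The experiments *)

Section uniform_kernel.
Context (R : realType) (d d' : measure_display) (T : measurableType d)
  (X : measurableType d') (q : nat -> T -> X) (k : nat).

(** Points count with multiplicity, so coinciding [q i t] add up their masses; [k.+1] points exclude
    an empty average. *)
Definition kuniform (mq : forall i, measurable_fun setT (q i)) (t : T) :
    {measure set X -> \bar R} :=
  mscale (k.+1%:R^-1)%:nng (msum (fun i => \d_(q i t)) k.+1).

Context (mq : forall i, measurable_fun setT (q i)).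

Local Lemma measurable_kuniform U : measurable U ->
  measurable_fun setT (kuniform mq ^~ U).
Proof.
move=> mU; apply: emeasurable_funM => //.
apply: emeasurable_sum => i.
have -> : (fun t => \d_(q i t) U) = EFin \o (\1_U \o q i) :> (T -> \bar R).
  by apply/funext => t; rewrite /= diracE.
apply/measurable_EFinP; apply: measurableT_comp (mq i).
exact: measurable_indic.
Qed.

HB.instance Definition _ :=
  isKernel.Build _ _ _ _ _ (kuniform mq) measurable_kuniform.

Local Lemma kuniform_setT t : kuniform mq t setT = 1%E.
Proof.
transitivity ((k.+1%:R^-1)%:E * \sum_(i < k.+1) (1 : R)%:E)%E.
  by congr (_ * _)%E; apply: eq_bigr => i _; exact: diracT.
by rewrite sumEFin sumr_const card_ord -EFinM mulVf// pnatr_eq0.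
Qed.

HB.instance Definition _ :=
  Kernel_isProbability.Build _ _ _ _ _ (kuniform mq) kuniform_setT.

Lemma integral_kuniform (phi : X -> R) t :
  measurable_fun setT phi -> (forall x, 0 <= phi x) ->
  (\int[kuniform mq t]_x (phi x)%:E)%E =
  (k.+1%:R^-1 * \sum_(i < k.+1) phi (q i t))%:E.
Proof.
move=> mphi phi0.
have mE : measurable_fun setT (fun x => (phi x)%:E) by exact/measurable_EFinP.
have E0 x : (setT : set X) x -> (0 <= (phi x)%:E)%E by rewrite lee_fin.
rewrite ge0_integral_mscale// ge0_integral_measure_sum//= EFinM -sumEFin.
congr (_ * _)%E; apply: eq_bigr => i _.
by rewrite integral_dirac// diracT mul1e.
Qed.

End uniform_kernel.

Lemma bernoulli_prob_fin (R : realType) (p : R) (A : set bool) : 0 <= p <= 1 ->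
  bernoulli_prob p A = (p * \1_A true + (1 - p) * \1_A false)%:E.
Proof. by move=> p01; rewrite bernoulli_probE// !diracE EFinD !EFinM. Qed.

(** The bits 3m, 3m+1 and 3m+2 of t say whether m lies in the first, second and third encoded
    set. *)
Definition near_partition (t : nat -> bool) : Prop :=
  exists N, forall m, (N <= m)%N -> (t (3 * m) + t (3 * m + 1) + t (3 * m + 2) = 1)%N.

(* Off near-partitions all three slots are the empty set. *)
Definition slot (i : nat) (t : nat -> bool) (m : nat) : bool :=
  `[< near_partition t >] && t (3 * m + i)%N.

(** Supplies the eventual solutions for [eventually_solvable_ae], namely the point masses. *)
Lemma slot_sum (R : realType) (t : nat -> bool) :
  exists N, forall m, (N <= m)%N ->
    \sum_(i < 3) (slot i t m)%:R = `[< near_partition t >]%:R :> R.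
Proof.
rewrite /slot; have [[N tN]|np] := asboolP (near_partition t); last first.
  by exists 0%N => m _; rewrite !big_ord_recl big_ord0 /= !addr0.
exists N => m /tN tm; rewrite !big_ord_recl big_ord0 /= !addn0 addr0 addrA.
by rewrite -!natrD tm.
Qed.

Lemma interleave3 (x y z : nat -> bool) : exists t : nat -> bool,
  forall m, [/\ t (3 * m)%N = x m, t (3 * m + 1)%N = y m & t (3 * m + 2)%N = z m].
Proof.
exists (fun n => nth false [:: x (n %/ 3); y (n %/ 3); z (n %/ 3)]%N (n %% 3)%N).
by move=> m; rewrite (mulnC 3); split;
  rewrite ?modnMl ?modnMDl ?mulnK ?divnMDl//= ?addn0.
Qed.

(** The threshold 5/12 lies strictly between 1/3 and 1/2, which rules out both alternatives of the
    zero-one law. *)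
Lemma no_baire_solution (R : realType) (gamma : (nat -> bool) -> R) :
  baire_property [set x | gamma x < 5 / 12] ->
  (forall t, \sum_(i < 3) gamma (slot i t) = `[< near_partition t >]%:R) -> False.
Proof.
move=> bg gs.
have triple (x y z : nat -> bool) N : (forall m, (N <= m)%N -> (x m + y m + z m = 1)%N) ->
    gamma x + gamma y + gamma z = 1.
  move=> xyz; have [t tP] := interleave3 x y z.
  have np : near_partition t.
    by exists N => m /xyz; have [-> -> ->] := tP m.
  have := gs t; rewrite !big_ord_recl big_ord0 /= addr0 addrA asboolT//=.
  have sl i : slot i t = fun m => t (3 * m + i)%N.
    by apply/funext => m; rewrite /slot asboolT.
  rewrite !sl.
  have -> : (fun m => t (3 * m + 0)%N) = x.
    by apply/funext => m; rewrite addn0; have [] := tP m.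
  have -> : (fun m => t (3 * m + bump 0 0)%N) = y.
    by apply/funext => m; have [] := tP m.
  have -> : (fun m => t (3 * m + bump 0 (bump 0 0))%N) = z.
    by apply/funext => m; have [] := tP m.
  by [].
(* The empty set is not a near-partition and all its slots are empty, so its equation reads 3 *
   gamma(empty) = 0. *)
pose none : nat -> bool := fun=> false.
have g0 : gamma none = 0.
  have nnp : ~ near_partition none by move=> [N /(_ N (leqnn N))].
  have := gs none; rewrite !big_ord_recl big_ord0 /= addr0 asboolF//=.
  have sl i : slot i none = none by apply/funext => m; rewrite /slot andbF.
  by rewrite !sl; lra.
have compl (x y : nat -> bool) k : (forall m, (k <= m)%N -> y m = ~~ x m) -> gamma x + gamma y = 1.
  move=> xy; rewrite -[RHS](triple x y none k) ?g0 ?addr0// => m /xy ->.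
  by rewrite /none; case: (x m).
have [cA|cA] : comeager [set x | gamma x < 5 / 12] \/
    comeager (~` [set x | gamma x < 5 / 12]).
(* If x and y agree from k on, both complement the negation of x up to a finite set, so gamma takes
   the same value at x and y. *)
- apply: baire_zero_one => // x y k xy /=.
  have := compl x (negb \o x) k (fun _ _ => erefl).
  have := compl y (negb \o x) k (fun m km => congr1 negb (xy m km)).
  lra.
(* A generic t such that both t and its complement lie below the threshold. *)
- have [i b|t tA] := @comeager_generic bool _
    (fun i b => if i is 0%N then b else ~~ b) cA.
    by case: i; [exists b|exists (~~ b); rewrite negbK].
  have := tA 0%N; have := tA 1%N => /=.
  have := compl t (negb \o t) 0%N (fun _ _ => erefl).
  rewrite /comp /=; lra.
(* The letter at m names the block containing m; each block indicator takes both values, so all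
   three blocks can be made generic together. *)
- have [i b|t tA] := @comeager_generic (option bool) _
    (fun i a => if i is 0%N then a == Some true
                else if i is 1%N then a == Some false else a == None) cA.
    by case: i => [|[|i]]; case: b; do [by exists None|by exists (Some true)|by exists (Some false)].
  have := tA 0%N; have := tA 1%N; have := tA 2%N; rewrite /comp /=.
  have := triple (fun m => t m == Some true) (fun m => t m == Some false)
    (fun m => t m == None) 0%N.
  have part m : (0 <= m)%N ->
      ((t m == Some true) + (t m == Some false) + (t m == None) = 1)%N.
    by case: (t m) => [[]|].
  by move=> /(_ part) s1 /negP + /negP + /negP; rewrite -!leNgt; lra.
Qed.

Lemma measurable_near_partition (R : realType) :
  measurable [set t : cantor_borel R | near_partition t].
Proof.
have -> : [set t : cantor_borel R | near_partition t] =
    \bigcup_N \bigcap_(m in [set m | (N <= m)%N])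
      [set t : cantor_borel R |
        (t (3 * m) + t (3 * m + 1) + t (3 * m + 2))%N = 1%N].
  by apply/seteqP; split=> t /= [N]; [exists N|move=> _; exists N].
apply: bigcup_measurable => N _; apply: bigcap_measurableType => m _.
pose A i := [set t : cantor_borel R | t (3 * m + i)%N].
have mA i : measurable (A i) by exact: measurable_cantor_coordinate.
have -> : [set t : cantor_borel R |
      (t (3 * m) + t (3 * m + 1) + t (3 * m + 2))%N = 1%N] =
    (A 0%N `&` ~` A 1%N `&` ~` A 2%N) `|` (~` A 0%N `&` A 1%N `&` ~` A 2%N)
    `|` (~` A 0%N `&` ~` A 1%N `&` A 2%N).
  apply/seteqP; split=> t; rewrite /A /setU /setI /setC /= addn0;
    case: (t _) (t _) (t _) => [] [] [] //=; intuition congruence.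
by repeat apply: measurableU; repeat apply: measurableI => //; exact: measurableC.
Qed.

Lemma measurable_slot (R : realType) i :
  measurable_fun setT (slot i : cantor_borel R -> cantor_borel R).
Proof.
apply: measurable_cantor_map => m.
have -> : [set t : cantor_borel R | slot i t m] =
    [set t : cantor_borel R | near_partition t] `&`
    [set t : cantor_borel R | t (3 * m + i)%N].
  apply/seteqP; split=> t; rewrite /slot /=; first by move=> /andP[/asboolP].
  by case=> np ->; rewrite asboolT.
apply: measurableI; first exact: measurable_near_partition.
exact: measurable_cantor_coordinate.
Qed.

(** The factor 1/3 matches the uniform choice among three slots, so comparing masses of {true} gives
    exactly the equations. *)
Definition partition_prob (R : realType) (t : cantor_borel R) : R :=
  `[< near_partition t >]%:R / 3.

Lemma partition_prob01 (R : realType) (t : cantor_borel R) :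
  0 <= partition_prob t <= 1.
Proof. by rewrite /partition_prob; case: asboolP => _ /=; lra. Qed.

Lemma measurable_bernoulli_partition_prob (R : realType) :
  measurable_fun setT
    (fun t : cantor_borel R =>
       bernoulli_prob (partition_prob t) : pprobability bool R).
Proof.
apply: (measurableT_comp measurable_bernoulli_prob).
apply: measurable_funM => //.
have -> : (fun t : cantor_borel R => `[< near_partition t >]%:R : R) =
    \1_[set t : cantor_borel R | near_partition t].
  apply/funext => t; rewrite indicE.
  by case: asboolP => np; [rewrite mem_set|rewrite memNset].
by apply: measurable_indic; exact: (@measurable_near_partition R).
Qed.

(** The argument 2 means three slots, since [kuniform] averages over [k.+1] points. *)
Definition slot_experiment (R : realType) : R.-pker cantor_borel R ~> cantor_borel R :=
  kuniform R 2 (@measurable_slot R).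

Definition coin_experiment (R : realType) : R.-pker cantor_borel R ~> bool :=
  kprobability (@measurable_bernoulli_partition_prob R).

Lemma coin_experimentE (R : realType) (t : cantor_borel R) (T : set bool) :
  coin_experiment R t T =
  (partition_prob t * \1_T true + (1 - partition_prob t) * \1_T false)%:E.
Proof. exact/bernoulli_prob_fin/partition_prob01. Qed.

Lemma integral_slot_experiment (R : realType) (phi : cantor_borel R -> R)
    (t : cantor_borel R) :
  measurable_fun setT phi -> (forall x, 0 <= phi x) ->
  (\int[slot_experiment R t]_x (phi x)%:E =
   (3^-1 * \sum_(i < 3) phi (slot i t))%:E)%E.
Proof. exact: integral_kuniform. Qed.

(** The kernel tosses a coin with bias C; almost everywhere equality of the integrands gives equal
    integrals over every S. *)
Lemma slot_bayes_informative (R : realType) :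
  exists c : R.-pker (cantor_borel R * pprobability (cantor_borel R) R) ~> bool,
    forall (pi : pprobability (cantor_borel R) R) (S : set (cantor_borel R))
      (T : set bool), measurable S -> measurable T ->
    (\int[pi]_(t in S) \int[slot_experiment R t]_x c (x, pi) T =
     \int[pi]_(t in S) coin_experiment R t T)%E.
Proof.
pose c m (x : cantor_borel R) : R := (x m)%:R.
have mc m : measurable_fun setT (c m).
  have -> : c m = \1_[set x : cantor_borel R | x m].
    apply/funext => x; rewrite indicE /c; congr (nat_of_bool _)%:R.
    by apply/idP/idP => [/mem_set|/set_mem].
  by apply: measurable_indic; exact: (@measurable_cantor_coordinate R m).
have c01 m x : 0 <= c m x <= 1 by rewrite /c; case: (x m); rewrite lexx ler01.
have [C [mC C01 Ce]] := eventually_solvable_ae (@measurable_slot R) mc c01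
  (slot_sum R).
have mCb : measurable_fun setT
    (fun z => bernoulli_prob (C z) : pprobability bool R).
  exact: (measurableT_comp measurable_bernoulli_prob).
exists (kprobability mCb) => pi S T mS mT.
pose phi x := C (x, pi) * \1_T true + (1 - C (x, pi)) * \1_T false.
have mphi : measurable_fun setT phi.
  have mCpi : measurable_fun setT (fun x => C (x, pi)).
    exact: measurableT_comp mC (measurable_pair2 _).
  apply: measurable_funD; apply: measurable_funM => //.
  exact: measurable_funB.
have phi0 x : 0 <= phi x.
  have /andP[C0 C1] := C01 (x, pi).
  by rewrite addr_ge0// mulr_ge0// subr_ge0.
have fE t : (\int[slot_experiment R t]_x kprobability mCb (x, pi) T =
    (3^-1 * \sum_(i < 3) phi (slot i t))%:E)%E.
  transitivity (\int[slot_experiment R t]_x (phi x)%:E)%E.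
    by apply: eq_integral => x _; exact: bernoulli_prob_fin.
  exact: integral_slot_experiment.
under eq_integral do rewrite fE.
apply: ae_eq_integral => //.
- apply: measurable_funTS; apply/measurable_EFinP; apply: measurable_funM => //.
  apply: measurable_sum => i.
  exact: measurableT_comp mphi (@measurable_slot R i).
- apply: measurable_funTS.
  exact: measurable_kernel (coin_experiment R) T mT.
have := Ce pi; apply: filterS => t Ct _.
rewrite coin_experimentE; congr EFin.
(* The mass of T is affine in the bias, so the equation for C settles every T. *)
rewrite /phi big_split /= -!mulr_suml sumrB sumr_const card_ord Ct.
by rewrite /partition_prob; field.
Qed.

(** The bias gamma of c is Borel, so its sublevel set has the Baire property, while the composite
    evaluated on {true} says that gamma solves all the equations. *)
Lemma slot_not_informative (R : realType) (c : R.-pker cantor_borel R ~> bool) :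
  ~ is_composite (coin_experiment R) c (slot_experiment R).
Proof.
move=> kc.
pose gamma x := fine (c x [set true]).
have cfin x : c x [set true] = (gamma x)%:E.
  rewrite fineK// ge0_fin_numE//; apply: (@le_lt_trans _ _ 1%E); last exact: ltry.
  by rewrite -(prob_kernel (s := c) x); apply: le_measure; rewrite ?inE.
have gamma0 x : 0 <= gamma x by rewrite fine_ge0.
have mgamma : measurable_fun setT gamma.
  apply: (measurableT_comp (fine_measurable measurableT)).
  exact: measurable_kernel.
apply: (@no_baire_solution R gamma).
  apply: cantor_measurable_baire; rewrite -[X in measurable X]setTI.
  rewrite (_ : [set x | _] = gamma @^-1` `]-oo, (5 / 12)[).
    by apply: mgamma => //; exact: measurable_itv.
  by apply/seteqP; split=> x; rewrite /= in_itv.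
move=> t; have := kc t [set true] I.
rewrite /kcomp_noparam; under eq_integral do rewrite cfin.
rewrite integral_slot_experiment// coin_experimentE !indicE mem_set// memNset//.
by rewrite mulr1 mulr0 addr0 /partition_prob => -[et]; lra.
Qed.

Local Open Scope ereal_scope.

Theorem proposition5p19 (R : realType) :
  exists (dTheta dX dY : measure_display)
    (Theta : measurableType dTheta) (X : measurableType dX)
    (Y : measurableType dY),
    [/\ standard_borel R Theta, standard_borel R X & standard_borel R Y] /\
    exists (f : R.-pker Theta ~> X) (g : R.-pker Theta ~> Y),
      (exists c : R.-pker (X * pprobability Theta R) ~> Y,
         forall (pi : pprobability Theta R) (S : set Theta) (T : set Y),
           measurable S -> measurable T ->
           \int[pi]_(theta in S) \int[f theta]_x c (x, pi) T
           = \int[pi]_(theta in S) g theta T) /\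
      ~ (exists c : R.-pker X ~> Y, is_composite g c f).
Proof.
exists _, _, _, (cantor_borel R), (cantor_borel R), bool; split.
  split; [exact: standard_borel_cantor|exact: standard_borel_cantor|].
  exact: standard_borel_bool.
exists (slot_experiment R), (coin_experiment R).
split; first exact: slot_bayes_informative.
by move=> [c /slot_not_informative].
Qed.
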